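(* There exist absolute constants $\varepsilon_0,C_1,C_2,C_3>0$ such that the following holds. Let $d\ge 1$ be an integer, $0<\varepsilon<\varepsilon_0$, $0<\delta<1/2$, and let $k=28\cdot 64^2\cdot\varepsilon^{-2}\log(1/\delta)$. Let $h:[d]\to[k]$ be drawn from an $r_h$-wise independent family and $\sigma:[d]\to\{-1,1\}$ be drawn (independently of $h$) from an $r_\sigma$-wise independent family, where $r_h\ge C_1\log(k/\delta)$ and $r_\sigma\ge C_2\log(1/\delta)$. Define the random matrix $A\in\{-1,0,1\}^{k\times d}$ by $A_{i,j}=\delta_{i,j}\sigma(j)$, where $\delta_{i,j}$ is the indicator that $h(j)=i$. Let $x\in\mathbb{R}^d$ satisfy $\|x\|_2=1$ and $\|x\|_\infty\le c$, where $c=C_3\sqrt{\varepsilon/(\log(1/\delta)\log(k/\delta))}$. Then $$\Pr_{h,\sigma}\big[\,|\|Ax\|_2^2-1|>\varepsilon\,\big]<3\delta .$$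
   Context: $[n]=\{1,\dots,n\}$. A family of functions $[n]\to[m]$ is $r$-wise independent if a uniformly random member maps any $r$ distinct inputs to independent uniform values in $[m]$. Logarithms are base $2$. *)

(* Defs.v *)
From HB Require Import structures.
From mathcomp Require Import all_boot all_order all_algebra.
From mathcomp Require Import reals normedtype exp.
Set Implicit Arguments.
Unset Strict Implicit.
Unset Printing Implicit Defensive.
Import Order.TTheory GRing.Theory Num.Theory.
Import numFieldNormedType.Exports.

Local Open Scope ring_scope.

Definition log2 (R : realType) (x : R) : R := ln x / ln 2.

Definition l2norm (R : realType) (n : nat) (x : 'cV[R]_n) : R :=
  Num.sqrt (\sum_i (x i 0) ^+ 2).

(* Probability of the event E when w is drawn uniformly from Omega. *)
Definition unif_prob (R : realType) (Omega : finType) (E : pred Omega) : R :=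
  #|[set w | E w]|%:R / #|Omega|%:R.

(* A family of functions I -> T is indexed by a finite type Omega of seeds, so
   that repeated members are allowed; drawing a uniformly random member means
   drawing a uniform seed.  The values at the inputs in J are jointly uniform
   and independent: the marginals are uniform and the joint mass function on J
   is the product of the marginal ones (J = set0 forces Omega to be nonempty).
   J ranges over all sets of at most r inputs; this is the same as exactly r
   inputs when r <= #|I|, and means full independence (instead of no condition
   at all) when r > #|I|. *)
Definition rwise_independent (R : realType) (Omega I T : finType)
    (f : Omega -> I -> T) (r : nat) : Prop :=
  forall J : {set I}, (#|J| <= r)%N ->
    (forall (i : I) (t : T), i \in J ->
       unif_prob R (fun w => f w i == t) = #|T|%:R^-1) /\
    (forall v : I -> T,
       unif_prob R (fun w => [forall i in J, f w i == v i]) =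
       \prod_(i in J) unif_prob R (fun w => f w i == v i)).

(* The number of rows: 28 * 64^2 * eps^-2 * log2(1/delta), rounded up. *)
Definition sketch_dim (R : realType) (eps delta : R) : nat :=
  `|Num.ceil (28%:R * 64%:R ^+ 2 * eps ^- 2 * log2 (1 / delta))|%N.

(* The element -1 or 1 of {-1, 1} is encoded by a boolean b as (-1) ^+ b. *)
Definition sketch_mx (R : realType) (k d : nat)
    (h : 'I_d -> 'I_k) (sigma : 'I_d -> bool) : 'M[R]_(k, d) :=
  \matrix_(i < k, j < d) ((h j == i)%:R * (-1) ^+ sigma j).

(* Main.v *)
(** Write B_b for the mass of x^2 hashed to bucket b, S_b for the signed sum of
    bucket b, Z = sum_b S_b^2 - 1 = sum_b (S_b^2 - B_b) for the error, and
    L = log2 (1/delta).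

    Hashing: apart from probability 2 delta, every B_b is at most
    theta = eps / (1024 L) and the collision mass
    sum_(i <> j, h i = h j) x_i^2 x_j^2 is at most 4/k.  Both tails come from the
    moment method applied to n-tuples of events with pairwise disjoint supports:
    such tuples are independent, so their expected sum is at most the n-th power
    of the expected sum, while discarding overlapping supports loses little
    because the x_i are small.

    Signs: for such an h and lam = 32 L / eps, fully random signs satisfy
    E exp(+-lam Z) <= exp(16 lam^2 * 4/k) <= exp(4L/7).  This bounds the moment
    E Z^(2t) with t ~ L, which only involves 4t signs and is therefore the same
    for the given family, and Markov's inequality concludes. *)
Require Import Defs.
From HB Require Import structures.
From mathcomp Require Import all_boot all_order all_algebra.
From mathcomp Require Import reals normedtype sequences exp ring lra.
Set Implicit Arguments.
Unset Strict Implicit.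
Unset Printing Implicit Defensive.
Import Order.TTheory GRing.Theory Num.Theory.
Import numFieldNormedType.Exports.

Local Open Scope ring_scope.

(** * Averages and probabilities over a finite set of seeds *)

Section Averages.
Variables (R : realType) (Omega : finType).
Implicit Types (g : Omega -> R) (E : pred Omega).

Definition avg g : R := (\sum_w g w) / #|Omega|%:R.

Lemma avg_ext g1 g2 : g1 =1 g2 -> avg g1 = avg g2.
Proof. by move=> e; rewrite /avg (eq_bigr g2). Qed.

Lemma avg_ge0 g : (forall w, 0 <= g w) -> 0 <= avg g.
Proof. by move=> g0; rewrite divr_ge0// sumr_ge0. Qed.

Lemma ler_avg g1 g2 : (forall w, g1 w <= g2 w) -> avg g1 <= avg g2.
Proof. by move=> le12; rewrite ler_wpM2r ?invr_ge0// ler_sum. Qed.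

Lemma avgD g1 g2 : avg (fun w => g1 w + g2 w) = avg g1 + avg g2.
Proof. by rewrite /avg big_split mulrDl. Qed.

Lemma avgZ (a : R) g : avg (fun w => a * g w) = a * avg g.
Proof. by rewrite /avg -mulr_sumr mulrA. Qed.

Lemma avg_sum (I : Type) (s : seq I) (P : pred I) (F : I -> Omega -> R) :
  avg (fun w => \sum_(i <- s | P i) F i w) = \sum_(i <- s | P i) avg (F i).
Proof. by rewrite /avg exchange_big/= mulr_suml. Qed.

Lemma avg_cst (a : R) : (0 < #|Omega|)%N -> avg (fun=> a) = a.
Proof.
by move=> n0; rewrite /avg sumr_const -[X in X / _]mulr_natr mulfK// pnatr_eq0 -lt0n.
Qed.

Lemma avg_involutive (s : Omega -> Omega) g :
  involutive s -> avg (g \o s) = avg g.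
Proof.
by move=> sK; rewrite /avg; congr (_ / _); rewrite [RHS](reindex_inj (inv_inj sK)).
Qed.

Lemma unif_probE E : unif_prob R E = avg (fun w => (E w)%:R).
Proof.
rewrite /unif_prob /avg -sum1_card natr_sum big_mkcond/=; congr (_ / _).
by apply: eq_bigr => w _; rewrite inE; case: (E w).
Qed.

Lemma unif_prob_markov E g (a : R) : 0 < a -> (forall w, 0 <= g w) ->
  (forall w, E w -> a <= g w) -> unif_prob R E <= avg g / a.
Proof.
move=> a0 g0 Ea; rewrite ler_pdivlMr// unif_probE mulrC -avgZ; apply: ler_avg => w.
by case: (boolP (E w)) => [/Ea|_]; rewrite ?mulr1 ?mulr0.
Qed.

Lemma unif_prob_or E1 E2 :
  unif_prob R (fun w => E1 w || E2 w) <= unif_prob R E1 + unif_prob R E2.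
Proof.
rewrite !unif_probE -avgD; apply: ler_avg => w.
by case: (E1 w); case: (E2 w); rewrite -natrD ler_nat.
Qed.

Lemma unif_prob_exists (J : finType) (F : J -> pred Omega) :
  unif_prob R (fun w => [exists j, F j w]) <= \sum_j unif_prob R (F j).
Proof.
rewrite (eq_bigr (fun j => avg (fun w => (F j w)%:R))); last first.
  by move=> j _; rewrite unif_probE.
rewrite -avg_sum unif_probE; apply: ler_avg => w.
case: existsP => [[j Fj]|_]; last by rewrite sumr_ge0.
by rewrite (bigD1 j)//= Fj lerDl sumr_ge0.
Qed.

End Averages.

(** Condition on the first seed: the conditional probability is at most [1] on [bad] and at most [p]
    elsewhere. *)
Lemma unif_prob_fiber_le (R : realType) (H S : finType) (bad : pred H)
    (E : H -> pred S) (p : R) : 0 <= p -> (0 < #|H|)%N ->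
  (forall h, ~~ bad h -> unif_prob R (E h) <= p) ->
  unif_prob R (fun w : H * S => E w.1 w.2) <= unif_prob R bad + p.
Proof.
move=> p0 H0 Ep.
have -> : unif_prob R (fun w : H * S => E w.1 w.2)
    = avg (fun h => unif_prob R (E h)).
  rewrite unif_probE /avg card_prod natrM invfM mulrCA [RHS]mulrC; congr (_ * _).
  rewrite mulrC; under [RHS]eq_bigr do rewrite unif_probE /avg.
  by rewrite -mulr_suml mulrC (pair_bigA _ (fun h s => (E h s)%:R : R)).
have -> : unif_prob R bad + p = avg (fun h => (bad h)%:R + p).
  by rewrite avgD avg_cst// unif_probE.
apply: ler_avg => h; case: (boolP (bad h)) => [_|/Ep]; last by rewrite add0r.
rewrite -[X in X <= _]addr0 lerD// unif_probE.
(* Over an empty [S] the average is a division by zero, hence [0]. *)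
case: (posnP #|S|) => [S0|S0]; first by rewrite /avg S0 invr0 mulr0.
rewrite -[leRHS](avg_cst 1 S0); apply: ler_avg => s.
by rewrite lern1 leq_b1.
Qed.

(** * Replacing a limited-independence family by a uniform function *)

Section Transfer.
Variables (R : realType) (I T : finType).
Implicit Types (J K : {set I}) (G : (I -> T) -> R).

Definition depends_on J G := forall u v : I -> T, {in J, u =1 v} -> G u = G v.

Definition uavg G : R := avg (fun v : {ffun I -> T} => G v).

Lemma depends_onW J K G : J \subset K -> depends_on J G -> depends_on K G.
Proof. by move=> /subsetP JK dG u v uv; apply: dG => i /JK; apply: uv. Qed.

Lemma depends_onM J G1 G2 : depends_on J G1 -> depends_on J G2 ->
  depends_on J (fun u => G1 u * G2 u).
Proof. by move=> d1 d2 u v uv; rewrite (d1 _ _ uv) (d2 _ _ uv). Qed.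

Lemma card_agree J (u : I -> T) :
  #|[set v : {ffun I -> T} | [forall i in J, u i == v i]]|
  = (#|T| ^ (#|I| - #|J|))%N.
Proof.
pose F i : pred T := if i \in J then pred1 (u i) else predT.
have -> : #|[set v : {ffun I -> T} | [forall i in J, u i == v i]]|
   = #|family F|.
  apply: eq_card => v; rewrite !inE; apply/forallP/forallP => /= uv i.
    by move: (uv i); rewrite /F; case: ifP => //= _; rewrite inE eq_sym.
  by apply/implyP => iJ; move: (uv i); rewrite /F iJ inE eq_sym.
rewrite card_family foldrE big_map big_enum/=.
rewrite (bigID (mem J))/= big1 => [|i iJ]; last by rewrite /F iJ card1.
rewrite mul1n (eq_bigr (fun=> #|T|)); last by move=> i /negbTE iJ; rewrite /F iJ.
rewrite prod_nat_const; congr (_ ^ _)%N.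
by rewrite -(cardC (mem J)) addKn.
Qed.

Variables (Omega : finType) (f : Omega -> I -> T) (r : nat).
Hypothesis indep : rwise_independent R f r.

(** Take [J = set0]: the empty product is [1], whereas a probability over no seeds is [0]. *)
Lemma rwise_card_gt0 (v : I -> T) : (0 < #|Omega|)%N.
Proof.
have J0 : (#|@set0 I| <= r)%N by rewrite cards0.
have [_ /(_ v)] := indep J0.
rewrite big_set0 /unif_prob; case: (posnP #|Omega|) => // ->.
by rewrite invr0 mulr0 => /eqP; rewrite eq_sym oner_eq0.
Qed.

Hypothesis T_gt0 : (0 < #|T|)%N.

Lemma rwise_agree J (v : I -> T) : (#|J| <= r)%N ->
  unif_prob R (fun w => [forall i in J, f w i == v i]) = #|T|%:R^-1 ^+ #|J|.
Proof.
move=> Jr; have [m ->] := indep Jr.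
by rewrite (eq_bigr (fun=> #|T|%:R^-1)) ?prodr_const// => i /m ->.
Qed.

(** Double counting: [D] runs over all functions [v], weighted by the probability that [f] agrees
    with [v] on [J]. Each seed is met once for every extension of its values on [J], which produces
    the power of [#|T|] that is cancelled at the end. *)
Lemma avg_transfer J G : (#|J| <= r)%N -> depends_on J G ->
  avg (fun w => G (f w)) = uavg G.
Proof.
move=> Jr dG.
pose D : R := \sum_(v : {ffun I -> T}) G v * #|T|%:R^-1 ^+ #|J|.
have D1 : D = avg (fun w => G (f w)) * (#|T| ^ (#|I| - #|J|))%:R.
  rewrite /D; under eq_bigr => v _ do
    rewrite -(rwise_agree v Jr) unif_probE -avgZ.
  rewrite -avg_sum mulrC -avgZ; apply: avg_ext => w.
  rewrite -(card_agree J (f w)) -sum1_card natr_sum mulr_suml.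
  rewrite big_mkcond [RHS]big_mkcond/=.
  apply: eq_bigr => v _; rewrite inE; case: ifP => [/forallP e|].
    by rewrite mulr1 mul1r; apply: dG => i iJ; apply/esym/eqP; move: (e i); rewrite iJ.
  by rewrite mulr0.
have T0 n : (#|T| ^ n)%:R != 0 :> R by rewrite pnatr_eq0 -lt0n expn_gt0 T_gt0.
apply: (mulIf (T0 (#|I| - #|J|)%N)); rewrite -D1 /D -mulr_suml /uavg /avg -mulrA.
have e : (#|T| ^ #|I| = #|T| ^ (#|I| - #|J|) * #|T| ^ #|J|)%N.
  by rewrite -expnD subnK// max_card.
congr (_ * _); rewrite card_ffun exprVn -natrX e natrM invfM mulrAC.
by rewrite mulVf// mul1r.
Qed.

End Transfer.

Lemma avg_pairM (R : realType) (A B : finType) (g1 : A -> R) (g2 : B -> R) :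
  avg (fun p : A * B => g1 p.1 * g2 p.2) = avg g1 * avg g2.
Proof.
rewrite /avg card_prod natrM invfM mulrACA; congr (_ * _).
by rewrite big_distrlr/= (pair_bigA _ (fun i j => g1 i * g2 j)).
Qed.

(** * Independence of disjoint coordinates of a uniform function *)

Section UniformProduct.
Variables (R : realType) (I T : finType).
Implicit Types (J U : {set I}) (G : (I -> T) -> R).

(* Exchanging the coordinates in J between two independent uniform functions
   preserves their joint law. *)
Lemma uavgM J G1 G2 : depends_on J G1 -> depends_on (~: J) G2 ->
  uavg (fun u => G1 u * G2 u) = uavg G1 * uavg G2.
Proof.
move=> d1 d2; pose V := {ffun I -> T}.
pose mix (u v : V) : V := [ffun i => if i \in J then u i else v i].
pose s (p : V * V) := (mix p.1 p.2, mix p.2 p.1).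
have sK : involutive s.
  by case=> u v; congr pair; apply/ffunP => i; rewrite !ffunE; case: (i \in J).
rewrite /uavg -avg_pairM -(avg_involutive _ sK)/=.
(* After the exchange both factors see only [p.1]; the factor [1] is the average over [p.2]. *)
transitivity (avg (fun p : V * V => (G1 p.1 * G2 p.1) * 1)).
  rewrite (avg_pairM (fun u : V => G1 u * G2 u) (fun=> 1)).
  case: (posnP #|V|) => [V0|V0]; first by rewrite /avg V0 invr0 mulr0 mul0r.
  by rewrite avg_cst// mulr1.
apply: avg_ext => -[u v] /=; rewrite mulr1; congr (_ * _).
  by apply: d1 => i iJ; rewrite ffunE iJ.
by apply: d2 => i; rewrite inE ffunE => /negbTE ->.
Qed.

End UniformProduct.

(** * The moment method on tuples with disjoint supports *)

Section LimitedIndependence.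
Variables (R : realType) (I T : finType).
Variables (Omega : finType) (f : Omega -> I -> T) (r : nat).
Hypothesis indep : rwise_independent R f r.
Hypothesis T_gt0 : (0 < #|T|)%N.
Implicit Types (J U : {set I}) (G g : (I -> T) -> R).

(* The random family f has the same average of g as a uniform function, also
   after conditioning on the values at r - m further inputs. *)
Definition transfers m g := forall J G, (#|J| + m <= r)%N -> depends_on J G ->
  avg (fun w => G (f w) * g (f w)) = uavg (fun u => G u * g u).

Lemma transfers_avg m g : (m <= r)%N -> transfers m g ->
  avg (fun w => g (f w)) = uavg g.
Proof.
move=> mr /(_ set0 (fun=> 1)); rewrite cards0 => /(_ mr) tg.
transitivity (avg (fun w => 1 * g (f w))); first by apply: avg_ext => w; rewrite mul1r.
by rewrite tg//; apply: avg_ext => w; rewrite mul1r.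
Qed.

Lemma transfers_ext m g1 g2 : g1 =1 g2 -> transfers m g1 -> transfers m g2.
Proof.
move=> e t J G Jr dG; transitivity (avg (fun w => G (f w) * g1 (f w))).
  by apply: avg_ext => w; rewrite e.
by rewrite (t J G)//; apply: avg_ext => w; rewrite e.
Qed.

Lemma transfers_cst a : transfers 0 (fun=> a).
Proof.
move=> J G; rewrite addn0 => Jr dG.
apply: (avg_transfer indep T_gt0 (J := J) (G := fun u => G u * a)) => // u v uv.
by rewrite (dG _ _ uv).
Qed.

(** The factor [a p] is absorbed into the conditioning function [G], at a cost of at most [s]
    inputs. Iterating this handles products of several local factors. *)
Lemma transfers_sumM (P : finType) (C : pred P) (supp : P -> {set I})
    (a g : P -> (I -> T) -> R) (s m : nat) :
  (forall p, C p -> #|supp p| <= s)%N ->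
  (forall p, C p -> depends_on (supp p) (a p)) ->
  (forall p, C p -> transfers m (g p)) ->
  transfers (s + m) (fun u => \sum_(p | C p) a p u * g p u).
Proof.
move=> ss da tg J G Jr dG.
transitivity (avg (fun w => \sum_(p | C p) (G (f w) * a p (f w)) * g p (f w))).
  by apply: avg_ext => w; rewrite mulr_sumr; apply: eq_bigr => p _; rewrite mulrA.
rewrite avg_sum.
transitivity (\sum_(p | C p) uavg (fun u => (G u * a p u) * g p u)); last first.
  rewrite /uavg -avg_sum; apply: avg_ext => u.
  by rewrite mulr_sumr; apply: eq_bigr => p _; rewrite mulrA.
apply: eq_bigr => p Cp.
apply: (tg p Cp (J :|: supp p) (fun u => G u * a p u)).
  apply: leq_trans Jr; rewrite addnA leq_add2r.
  apply: leq_trans (leq_card_setU _ _) _.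
  by rewrite leq_add2l ss.
apply: depends_onM; first by apply: depends_onW dG; rewrite subsetUl.
by apply: depends_onW (da p Cp); rewrite subsetUr.
Qed.

Section DisjointTuples.
Variables (P : finType) (supp : P -> {set I}) (a : P -> (I -> T) -> R).
Variables (s : nat) (Q : R).
Hypothesis supp_s : forall p, (#|supp p| <= s)%N.
Hypothesis a_supp : forall p, depends_on (supp p) (a p).
Hypothesis a_ge0 : forall p u, 0 <= a p u.
Hypothesis a_avg : \sum_p uavg (a p) <= Q.

(* The sum of a p_1 * ... * a p_n over the n-tuples whose supports are pairwise
   disjoint and disjoint from U. *)
Fixpoint disjoint_tuple_sum n U (u : I -> T) : R :=
  if n is n'.+1 then
    \sum_(p | [disjoint supp p & U])
      a p u * disjoint_tuple_sum n' (U :|: supp p) u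
  else 1.

Lemma disjoint_tuple_sum_ge0 n U u : 0 <= disjoint_tuple_sum n U u.
Proof.
elim: n U => [|n IH] U //=; apply: sumr_ge0 => p _.
exact: mulr_ge0 (a_ge0 _ _) (IH _).
Qed.

(** All supports in the tuple avoid [U]; this is what makes the head of a longer tuple independent
    of its tail. *)
Lemma disjoint_tuple_sum_depends n U :
  depends_on (~: U) (disjoint_tuple_sum n U).
Proof.
elim: n U => [|n IH] U u v uv //=; apply: eq_bigr => p pU; congr (_ * _).
  apply: a_supp => i ip; apply: uv; rewrite inE.
  by have /pred0P/(_ i)/= := pU; rewrite ip /= => ->.
by apply: IH => i; rewrite !inE negb_or => /andP[iU _]; apply: uv; rewrite inE.
Qed.

Lemma transfers_disjoint_tuple_sum n U :
  transfers (s * n) (disjoint_tuple_sum n U).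
Proof.
elim: n U => [|n IH] U; first by rewrite muln0; apply: transfers_cst.
by rewrite mulnS; apply: transfers_sumM => p _ //; apply: IH.
Qed.

(** Head and tail depend on disjoint coordinates, so the average factors; dropping the disjointness
    constraint on the head only adds nonnegative terms. *)
Lemma uavg_disjoint_tuple_sum n U :
  (0 <= Q) -> uavg (disjoint_tuple_sum n U) <= Q ^+ n.
Proof.
move=> Q0; elim: n U => [|n IH] U.
  rewrite /uavg expr0; case: (posnP #|{ffun I -> T}|) => [V0|V0].
    by rewrite /avg V0 invr0 mulr0.
  by rewrite avg_cst.
rewrite /uavg avg_sum exprS.
apply: (@le_trans _ _ (\sum_(p | [disjoint supp p & U]) uavg (a p) * Q ^+ n)).
  apply: ler_sum => p pU.
  have dW : depends_on (~: supp p) (disjoint_tuple_sum n (U :|: supp p)).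
    by apply: depends_onW (@disjoint_tuple_sum_depends _ _); rewrite setCS subsetUr.
  have /= e := uavgM (@a_supp p) dW; rewrite /uavg in e *.
  by rewrite e ler_wpM2l ?IH// avg_ge0.
rewrite -mulr_suml ler_wpM2r// ?exprn_ge0//; apply: le_trans a_avg.
rewrite [leRHS](bigID [pred p | [disjoint supp p & U]])/= lerDl.
by apply: sumr_ge0 => p _; rewrite avg_ge0.
Qed.

(** Whatever members were chosen before, they block at most [s * n] inputs beyond [U], so each
    further choice still contributes at least [b]. *)
Lemma disjoint_tuple_sum_lb (b : R) n U u : 0 <= b ->
  (forall V : {set I}, (#|V| <= #|U| + s * n)%N ->
     b <= \sum_(p | [disjoint supp p & V]) a p u) ->
  b ^+ n <= disjoint_tuple_sum n U u.
Proof.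
move=> b0; elim: n U => [|n IH] U bV //=.
apply: (@le_trans _ _ (\sum_(p | [disjoint supp p & U]) a p u * b ^+ n)).
  by rewrite -mulr_suml exprS ler_wpM2r ?exprn_ge0// bV// leq_addr.
apply: ler_sum => p _; apply: ler_wpM2l => //; apply: IH => V leV.
apply: bV; apply: leq_trans leV _.
rewrite mulnS addnA leq_add2r; apply: leq_trans (leq_card_setU _ _) _.
by rewrite leq_add2l supp_s.
Qed.

(** Markov's inequality for the tuple sum, which has mean at most [Q ^+ n] and is at least [b ^+ n]
    on [E]. *)
Lemma unif_prob_disjoint_tuples (E : pred (I -> T)) (b : R) n :
  (s * n <= r)%N -> 0 <= Q -> 0 < b ->
  (forall u, E u -> forall V : {set I}, (#|V| <= s * n)%N ->
     b <= \sum_(p | [disjoint supp p & V]) a p u) ->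
  unif_prob R (fun w => E (f w)) <= (Q / b) ^+ n.
Proof.
move=> snr Q0 b0 Eb.
have := @unif_prob_markov R Omega (fun w => E (f w))
  (fun w => disjoint_tuple_sum n set0 (f w)) (b ^+ n).
rewrite exprn_gt0// => /(_ isT) H.
apply: (@le_trans _ _ (avg (fun w => disjoint_tuple_sum n set0 (f w)) / b ^+ n)).
  apply: H => w; first exact: disjoint_tuple_sum_ge0.
  move=> Ew; apply: disjoint_tuple_sum_lb; first exact: ltW.
  by move=> V; rewrite cards0; apply: Eb.
rewrite expr_div_n ler_wpM2r ?invr_ge0 ?exprn_ge0 ?(ltW b0)//.
rewrite (transfers_avg snr (@transfers_disjoint_tuple_sum _ _)).
by rewrite uavg_disjoint_tuple_sum.
Qed.

End DisjointTuples.
End LimitedIndependence.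

(** A weak form of the bound on the hyperbolic cosine, with an elementary proof. If
    [t ^+ 2 >= 1 / 4], both exponents are at most [2 * t ^+ 2]. Otherwise [expR t <= (1 - t)^-1] and
    its mirror image average to [(1 - t ^+ 2)^-1], and [(1 + 2 * u) * (1 - u) >= 1] for
    [u = t ^+ 2]. *)
Lemma expR_sym_le (R : realType) (t : R) :
  (expR t + expR (- t)) / 2 <= expR (2 * t ^+ 2).
Proof.
have t2 : 0 <= t ^+ 2 by rewrite sqr_ge0.
have expand2 y : (t + y) ^+ 2 = t ^+ 2 + 2 * t * y + y ^+ 2 by ring.
have [tge|tlt] := lerP (1 / 4) (t ^+ 2).
  have [t1 t1'] : t <= 2 * t ^+ 2 /\ - t <= 2 * t ^+ 2.
    have := sqr_ge0 (t + 1 / 2); have := sqr_ge0 (t + - (1 / 2)).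
    by rewrite !expand2 sqrrN !expr2 in tge *; split; lra.
  rewrite ler_pdivrMr// mulr_natr mulr2n.
  by apply: lerD; rewrite ler_expR.
have [tl tr] : t < 1 /\ - t < 1.
  have := sqr_ge0 (t + 1 / 2); have := sqr_ge0 (t + - (1 / 2)).
  by rewrite !expand2 sqrrN !expr2 in tlt *; split; lra.
have e1 : expR t <= (1 - t)^-1.
  rewrite -[t in expR t]opprK expRN lef_pV2 ?posrE ?expR_gt0 ?subr_gt0//.
  exact: expR_ge1Dx.
have e2 : expR (- t) <= (1 + t)^-1.
  have t10 : 0 < 1 + t by lra.
  by rewrite expRN lef_pV2 ?posrE ?expR_gt0// expR_ge1Dx.
apply: (@le_trans _ _ (1 - t ^+ 2)^-1).
  have -> : (1 - t ^+ 2)^-1 = ((1 - t)^-1 + (1 + t)^-1) / 2.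
    by field; rewrite !lt0r_neq0//; lra.
  by apply: ler_wpM2r; [rewrite invr_ge0|apply: lerD].
have := expR_ge1Dx (2 * t ^+ 2); set u := t ^+ 2 in t2 tlt *.
move=> e; rewrite -[leLHS]mul1r ler_pdivrMr; last by lra.
apply: (@le_trans _ _ ((1 + 2 * u) * (1 - u))); last by rewrite ler_wpM2r//; lra.
have : 0 <= u * (1 - 2 * u) by rewrite mulr_ge0//; lra.
by rewrite !mulrBr !mulrDl; lra.
Qed.

Lemma sqr_bump_sum (R : comPzRingType) (B : finType) (lam v : B -> R) (b0 : B) (a : R) :
  \sum_b lam b * (v b + (b == b0)%:R * a) ^+ 2
  = \sum_b lam b * v b ^+ 2 + lam b0 * (2 * a * v b0 + a ^+ 2).
Proof.
rewrite (bigD1 b0)//= [X in _ = X + _](bigD1 b0)//= eqxx mul1r.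
rewrite (eq_bigr (fun b => lam b * v b ^+ 2)); last first.
  by move=> b /negbTE ->; rewrite mul0r addr0.
by ring.
Qed.

(** * Exponential moments of the error under fully random signs *)

Section SignChaos.
Variables (R : realType) (I B : finType) (h : I -> B) (x : I -> R).
Implicit Types (s : seq I) (sg : I -> bool) (lam : B -> R).

Definition flip (i : I) sg : I -> bool := fun j => if j == i then ~~ sg j else sg j.

(** Flipping one sign is a measure-preserving involution. The condition [depends_on setT] expresses
    extensionality of [G], since [flip i u] is a plain function while the average runs over finite
    functions. *)
Lemma uavg_flip i (G : (I -> bool) -> R) : depends_on setT G ->
  uavg G = uavg (fun u => (G u + G (flip i u)) / 2).
Proof.
move=> dG.
pose fl (u : {ffun I -> bool}) := [ffun j => flip i u j].
have flK : involutive fl.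
  move=> u; apply/ffunP => j; rewrite !ffunE /flip !ffunE /flip.
  by case: eqP => //; rewrite negbK.
have e : uavg G = uavg (fun u => G (flip i u)).
  rewrite /uavg -(avg_involutive _ flK); apply: avg_ext => u /=.
  by apply: dG => j _; rewrite ffunE.
transitivity (uavg (fun u => 2^-1 * (G u + G (flip i u)))).
  by rewrite /uavg avgZ avgD -/(uavg G) -[X in _ + X]e -[in RHS]/(uavg G); field.
by apply: avg_ext => u; rewrite mulrC.
Qed.

Definition signed_sum s sg (b : B) : R :=
  \sum_(j <- s | h j == b) (-1) ^+ sg j * x j.

Definition bucket_mass s (b : B) : R := \sum_(j <- s | h j == b) x j ^+ 2.

(** A Rademacher chaos of order two with its diagonal removed. The weight varies with the bucket
    because the induction below raises it in one bucket at a time. *)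
Definition chaos lam s sg : R :=
  \sum_b lam b * (signed_sum s sg b ^+ 2 - bucket_mass s b).

(** This is the sum of [x i ^+ 2 * x j ^+ 2] over ordered pairs of distinct positions sharing a
    bucket. *)
Definition collision_mass s : R :=
  \sum_b bucket_mass s b ^+ 2 - \sum_(i <- s) x i ^+ 4.

Lemma bucket_mass_ge0 s b : 0 <= bucket_mass s b.
Proof. by apply: sumr_ge0 => j _; rewrite sqr_ge0. Qed.

Lemma signed_sum_cons i s sg b : signed_sum (i :: s) sg b =
  signed_sum s sg b + (b == h i)%:R * ((-1) ^+ sg i * x i).
Proof.
rewrite /signed_sum big_cons eq_sym; case: ifP => _; last by rewrite mul0r addr0.
by rewrite mul1r addrC.
Qed.

Lemma bucket_mass_cons i s b :
  bucket_mass (i :: s) b = bucket_mass s b + (b == h i)%:R * x i ^+ 2.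
Proof.
rewrite /bucket_mass big_cons eq_sym; case: ifP => _; last by rewrite mul0r addr0.
by rewrite mul1r addrC.
Qed.

(** The square of the new entry cancels against its mass, leaving only the cross term, linear in the
    sign of [i]. *)
Lemma chaos_cons lam i s sg : chaos lam (i :: s) sg =
  chaos lam s sg + 2 * lam (h i) * ((-1) ^+ sg i * x i) * signed_sum s sg (h i).
Proof.
have sgn2 : ((-1) ^+ sg i * x i) ^+ 2 = x i ^+ 2.
  by rewrite exprMn sqrr_sign mul1r.
rewrite /chaos.
transitivity (\sum_b lam b * (signed_sum s sg b
    + (b == h i)%:R * ((-1) ^+ sg i * x i)) ^+ 2
  - \sum_b lam b * (bucket_mass s b + (b == h i)%:R * x i ^+ 2)).
  rewrite -sumrB; apply: eq_bigr => b _.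
  by rewrite signed_sum_cons bucket_mass_cons mulrBr.
rewrite sqr_bump_sum sgn2.
have -> : \sum_b lam b * (bucket_mass s b + (b == h i)%:R * x i ^+ 2)
    = \sum_b lam b * bucket_mass s b + lam (h i) * x i ^+ 2.
  under eq_bigr do rewrite mulrDr; rewrite big_split/=; congr (_ + _).
  rewrite (bigD1 (h i))//= eqxx mul1r big1 ?addr0// => b /negbTE ->.
  by rewrite mul0r mulr0.
have -> : \sum_b lam b * (signed_sum s sg b ^+ 2 - bucket_mass s b)
    = \sum_b lam b * signed_sum s sg b ^+ 2 - \sum_b lam b * bucket_mass s b.
  by rewrite -sumrB; apply: eq_bigr => b _; rewrite mulrBr.
ring.
Qed.

Lemma collision_mass_cons i s : collision_mass (i :: s) =
  collision_mass s + 2 * x i ^+ 2 * bucket_mass s (h i).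
Proof.
rewrite /collision_mass big_cons.
have e := sqr_bump_sum (fun=> 1) (bucket_mass s) (h i) (x i ^+ 2).
have -> : \sum_b bucket_mass (i :: s) b ^+ 2 =
    \sum_b 1 * (bucket_mass s b + (b == h i)%:R * x i ^+ 2) ^+ 2.
  by apply: eq_bigr => b _; rewrite mul1r bucket_mass_cons.
rewrite e (eq_bigr (fun b => bucket_mass s b ^+ 2)) => [|b _]; last by rewrite mul1r.
by ring.
Qed.

Lemma depends_on_chaos lam s : depends_on setT (fun u => expR (chaos lam s u)).
Proof.
move=> u v uv; congr expR; apply: eq_bigr => b _; congr (_ * (_ ^+ 2 - _)).
by apply: eq_bigr => j _; rewrite uv ?inE.
Qed.

Lemma signed_sum_flip i s sg b : i \notin s ->
  signed_sum s (flip i sg) b = signed_sum s sg b.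
Proof.
move=> iNs; rewrite /signed_sum big_seq_cond [RHS]big_seq_cond.
apply: eq_bigr => j /andP[js _]; rewrite /flip.
by case: eqP => // ji; rewrite -ji js in iNs.
Qed.

Lemma chaos_flip lam i s sg : i \notin s -> chaos lam s (flip i sg) = chaos lam s sg.
Proof. by move=> iNs; apply: eq_bigr => b _; rewrite signed_sum_flip. Qed.

Lemma chaos_bump lam s sg b0 e :
  chaos (fun b => lam b + (b == b0)%:R * e) s sg =
  chaos lam s sg + e * (signed_sum s sg b0 ^+ 2 - bucket_mass s b0).
Proof.
rewrite /chaos; under eq_bigr do rewrite mulrDl; rewrite big_split/=; congr (_ + _).
rewrite (bigD1 b0)//= eqxx mul1r big1 ?addr0// => b /negbTE ->.
by rewrite !mul0r.
Qed.

(* Averaging over the sign of i multiplies by at most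
   exp (8 lam^2 x_i^2 S^2), S being the remaining signed sum of the bucket of i.
   This is absorbed by raising lam there; the bounds on lam leave room for the
   total increase. *)
Lemma uavg_expR_chaos Lam lam s : uniq s -> 0 <= Lam ->
  (forall b, - Lam <= lam b) ->
  (forall b, lam b <= Lam - 8 * Lam ^+ 2 * bucket_mass s b) ->
  uavg (fun u => expR (chaos lam s u)) <= expR (4 * Lam ^+ 2 * collision_mass s).
Proof.
move=> + Lam0; elim: s lam => [|i s IH] lam /=.
  move=> _ _ _; rewrite /collision_mass big_nil subr0 big1; last first.
    by move=> b _; rewrite /bucket_mass big_nil expr0n.
  have -> : uavg (fun u => expR (chaos lam [::] u)) = uavg (fun _ : I -> bool => 1).
    apply: avg_ext => u; rewrite /chaos big1 ?expR0// => b _.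
    by rewrite /signed_sum /bucket_mass !big_nil expr0n subrr mulr0.
  rewrite mulr0 expR0 /uavg; case: (posnP #|{ffun I -> bool}|) => [V0|V0].
    by rewrite /avg V0 invr0 mulr0.
  by rewrite avg_cst.
move=> /andP[iNs us] lam_ge lam_le.
set a2 := x i ^+ 2; have a20 : 0 <= a2 by rewrite sqr_ge0.
set b0 := h i; set B0 := bucket_mass s b0.
have B00 : 0 <= B0 by exact: bucket_mass_ge0.
(* The increase is the coefficient of [S ^+ 2] in [2 * t ^+ 2] at [t = 2 * lam b0 * y * S]. Raising
   the weight yields [S ^+ 2 - B0], and the missing [B0] is paid for by the prefactor in [step]. *)
pose lam' b := lam b + (b == b0)%:R * (8 * lam b0 ^+ 2 * a2).
have lam2 : lam b0 ^+ 2 <= Lam ^+ 2.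
  rewrite -ler_sqrt ?sqr_ge0// !sqrtr_sqr (ger0_norm Lam0) ler_norml lam_ge/=.
  apply: le_trans (lam_le _) _; rewrite gerDl oppr_le0.
  by rewrite mulr_ge0 ?bucket_mass_ge0 ?mulr_ge0 ?sqr_ge0.
have step u : (expR (chaos lam (i :: s) u) + expR (chaos lam (i :: s) (flip i u))) / 2
    <= expR (8 * Lam ^+ 2 * a2 * B0) * expR (chaos lam' s u).
  have fi : flip i u i = ~~ u i by rewrite /flip eqxx.
  rewrite !chaos_cons chaos_flip// signed_sum_flip// fi signrN -/b0.
  set C := chaos lam s u; set S := signed_sum s u b0.
  have sgn2 : ((-1) ^+ u i * x i) ^+ 2 = a2 by rewrite exprMn sqrr_sign mul1r.
  set y := (-1) ^+ u i * x i in sgn2 *.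
  have -> : 2 * lam b0 * (- (-1) ^+ u i * x i) * S = - (2 * lam b0 * y * S).
    by rewrite /y; ring.
  rewrite !expRD -mulrDr -mulrA.
  apply: le_trans (ler_wpM2l (expR_ge0 _) (expR_sym_le _)) _.
  rewrite chaos_bump -/C -/S -/B0 -!expRD ler_expR.
  have -> : 2 * (2 * lam b0 * y * S) ^+ 2 = 8 * lam b0 ^+ 2 * a2 * S ^+ 2.
    by rewrite -sgn2; ring.
  have : 8 * lam b0 ^+ 2 * a2 * B0 <= 8 * Lam ^+ 2 * a2 * B0.
    by rewrite !ler_wpM2r// ler_wpM2l.
  by rewrite mulrBr; lra.
have IH' : uavg (fun u => expR (chaos lam' s u))
    <= expR (4 * Lam ^+ 2 * collision_mass s).
  apply: IH => // b.
    rewrite /lam'; apply: le_trans (lam_ge b) _; rewrite lerDl mulr_ge0 ?ler0n//.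
    by rewrite mulr_ge0// mulr_ge0// sqr_ge0.
  (* Removing [i] lowers the mass of [b0] by [a2] and so frees [8 * Lam ^+ 2 * a2], enough for the
     increase by [lam2]. *)
  rewrite /lam'; have := lam_le b; rewrite bucket_mass_cons -/b0.
  have [->|_] := eqVneq b b0; last by rewrite !mul0r !addr0.
  have : 8 * lam b0 ^+ 2 * a2 <= 8 * Lam ^+ 2 * a2.
    by rewrite ler_wpM2r// ler_wpM2l.
  by rewrite !mul1r -/a2 mulrDr; lra.
rewrite (uavg_flip i); last exact: depends_on_chaos.
apply: le_trans (ler_avg (fun u : {ffun I -> bool} => step u)) _.
rewrite avgZ collision_mass_cons -/b0 -/B0 -/a2.
apply: (@le_trans _ _ (expR (8 * Lam ^+ 2 * a2 * B0) *
  expR (4 * Lam ^+ 2 * collision_mass s))).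
  by rewrite ler_wpM2l ?expR_ge0.
by rewrite -expRD ler_expR le_eqVlt; apply/orP; left; apply/eqP; ring.
Qed.

End SignChaos.

(** Applied to the squares of the entries this expands the collision mass; applied to the signed
    entries it expands the error. *)
Lemma fiber_sum_sqr (R : comPzRingType) (I B : finType) (h : I -> B) (y : I -> R) :
  \sum_b (\sum_(j | h j == b) y j) ^+ 2 = \sum_i y i ^+ 2
   + \sum_(p : I * I) ((p.1 != p.2) && (h p.1 == h p.2))%:R * (y p.1 * y p.2).
Proof.
transitivity (\sum_i \sum_j (h i == h j)%:R * (y i * y j)).
  rewrite [RHS](partition_big h xpredT)//=; apply: eq_bigr => b _.
  rewrite expr2 big_distrlr/=; apply: eq_bigr => i /eqP hi.
  rewrite big_mkcond/=; apply: eq_bigr => j _.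
  by rewrite hi eq_sym; case: eqP; rewrite ?mul1r ?mul0r.
rewrite -(pair_bigA _ (fun i j => ((i != j) && (h i == h j))%:R * (y i * y j))).
rewrite -big_split/=; apply: eq_bigr => i _.
rewrite (bigD1 i)//= [X in _ = _ + X](bigD1 i)//= !eqxx mul0r add0r mul1r expr2.
by congr (_ + _); apply: eq_bigr => j ji; rewrite (eq_sym i j) ji.
Qed.

(** * Tails of the bucket masses and of the collision mass *)

Section HashTails.
Variables (R : realType) (I B : finType) (x : I -> R) (c2 theta : R).
Variables (Omega : finType) (f : Omega -> I -> B) (r : nat).
Hypothesis indep : rwise_independent R f r.
Hypothesis B_gt0 : (0 < #|B|)%N.
Hypothesis x_norm : \sum_i x i ^+ 2 = 1.
Hypothesis x_small : forall i, x i ^+ 2 <= c2.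
Hypothesis c2_ge0 : 0 <= c2.
Hypothesis theta_gt0 : 0 < theta.

Let k : R := #|B|%:R.

Let k_gt0 : 0 < k. Proof. by rewrite ltr0n. Qed.

Lemma uavg_eq_value i b : (1 <= r)%N ->
  uavg (fun u : I -> B => (u i == b)%:R) = k^-1.
Proof.
move=> r1; have J1 : (#|[set i]| <= r)%N by rewrite cards1.
rewrite -(avg_transfer indep B_gt0 J1) => [|u v uv]; last by rewrite uv ?set11.
by have [/(_ i b (set11 i)) <- _] := indep J1; rewrite unif_probE.
Qed.

Lemma uavg_collision i j : (2 <= r)%N -> i != j ->
  uavg (fun u : I -> B => (u i == u j)%:R) = k^-1.
Proof.
move=> r2 ij; have J2 : (#|[set i; j]| <= r)%N by rewrite cards2 ij.
rewrite -(avg_transfer indep B_gt0 J2) => [|u v uv]; last first.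
  by rewrite !uv ?set21 ?set22.
(* Split the collision by the common value [b]: there are [k] values, each of probability
   [k^-1 ^+ 2]. *)
transitivity (avg (fun w => \sum_b
    [forall l in [set i; j], f w l == b]%:R : R)).
  apply: avg_ext => w; rewrite (bigD1 (f w i))//= big1 => [|b bi].
    rewrite addr0; congr (_%:R); congr nat_of_bool; apply/eqP/forallP => [e l|].
      by apply/implyP; rewrite !inE => /orP[]/eqP->; rewrite // e.
    by move=> /(_ j); rewrite set22/= => /eqP.
  case: forallP => // /(_ i); rewrite set21/= => /eqP e.
  by rewrite e eqxx in bi.
rewrite avg_sum (eq_bigr (fun=> k^-1 ^+ 2)) => [|b _].
  rewrite sumr_const cardT -cardE -[LHS]mulr_natl -/k.
  by rewrite expr2 mulrA mulfV ?mul1r ?lt0r_neq0.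
by rewrite -unif_probE (rwise_agree indep (fun=> b) J2) cards2 ij.
Qed.

Lemma sum_subset_le (V : {set I}) (y : I -> R) (a : R) :
  (forall i, y i <= a) -> \sum_(i in V) y i <= #|V|%:R * a.
Proof.
move=> ya; rewrite mulr_natl -sumr_const.
by apply: ler_sum => i _; exact: ya.
Qed.

(** Use tuples of single inputs hashed to [b], with expected sum [k^-1]. Discarding [n] inputs costs
    at most [n%:R * c2], so a heavy bucket keeps mass [theta / 2]. *)
Lemma bucket_tail b n : (1 <= n)%N -> (n <= r)%N -> n%:R * c2 <= theta / 2 ->
  unif_prob R (fun w => theta < bucket_mass (f w) x (index_enum I) b)
  <= (2 / (k * theta)) ^+ n.
Proof.
move=> n1 nr nc.
have r1 := leq_trans n1 nr.
have -> : 2 / (k * theta) = k^-1 / (theta / 2).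
  by field; rewrite !lt0r_neq0.
pose E (u : I -> B) := theta < bucket_mass u x (index_enum I) b.
pose a i (u : I -> B) := (u i == b)%:R * x i ^+ 2.
apply: (@unif_prob_disjoint_tuples _ _ _ _ _ _ indep B_gt0 _
  (fun i => [set i]) a 1 _ _ _ _ _ E) => //.
- by move=> i; rewrite cards1.
- by move=> i u v uv; rewrite /a uv ?set11.
- by move=> i u; rewrite mulr_ge0 ?sqr_ge0.
- rewrite (eq_bigr (fun i => k^-1 * x i ^+ 2)) -?mulr_sumr ?x_norm ?mulr1// => i _.
  rewrite -(uavg_eq_value i b r1) mulrC -[RHS]avgZ.
  by apply: avg_ext => u; rewrite mulrC.
- by rewrite mul1n.
- by rewrite invr_ge0 ltW.
- by rewrite divr_gt0.
move=> u tu V; rewrite mul1n => Vn.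
have Vc : \sum_(i in V) (u i == b)%:R * x i ^+ 2 <= theta / 2.
  apply: le_trans nc; apply: (@le_trans _ _ (#|V|%:R * c2)).
    apply: sum_subset_le => i; apply: le_trans (x_small i).
    by rewrite ler_piMl ?sqr_ge0// lern1 leq_b1.
  by rewrite ler_wpM2r// ler_nat.
have : bucket_mass u x (index_enum I) b = \sum_(i in V) (u i == b)%:R * x i ^+ 2
    + \sum_(i | [disjoint [set i] & V]) (u i == b)%:R * x i ^+ 2.
  rewrite /bucket_mass big_mkcond (bigID (mem V))/=; congr (_ + _).
    by apply: eq_bigr => i _; case: eqP; rewrite ?mul1r ?mul0r.
  apply: eq_big => i; first by rewrite disjoints1.
  by case: eqP; rewrite ?mul1r ?mul0r.
by move: tu Vc; rewrite /E /a => tu Vc e; rewrite e in tu; lra.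
Qed.

(** Use tuples of colliding pairs, with expected sum at most [k^-1]. The event includes light
    buckets so that discarding [2 * n] inputs removes at most half of the mass [4 / k]. *)
Lemma collision_tail n : (1 <= n)%N -> (2 * n <= r)%N ->
  4 * n%:R * c2 * theta <= 2 / k ->
  unif_prob R (fun w =>
    (4 / k < collision_mass (f w) x (index_enum I)) &&
    [forall b, bucket_mass (f w) x (index_enum I) b <= theta])
  <= 2^-1 ^+ n.
Proof.
move=> n1 nr nc.
have r2 : (2 <= r)%N by apply: leq_trans nr; rewrite leq_pmulr.
have -> : 2^-1 = k^-1 / (2 / k) :> R by field; rewrite !lt0r_neq0.
pose E (u : I -> B) := (4 / k < collision_mass u x (index_enum I)) &&
    [forall b, bucket_mass u x (index_enum I) b <= theta].
pose a (p : I * I) (u : I -> B) : R := ((p.1 != p.2) && (u p.1 == u p.2))%:R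
  * (x p.1 ^+ 2 * x p.2 ^+ 2).
have xx0 (p : I * I) : 0 <= x p.1 ^+ 2 * x p.2 ^+ 2 by rewrite mulr_ge0 ?sqr_ge0.
have a0 p u : 0 <= a p u by rewrite mulr_ge0 ?ler0n.
apply: (@unif_prob_disjoint_tuples _ _ _ _ _ _ indep B_gt0 _
  (fun p : I * I => [set p.1; p.2]) a 2 k^-1 _ _ _ _ E) => //.
- by move=> p; rewrite cards2; case: (_ != _).
- by move=> p u v uv; rewrite /a !uv ?set21 ?set22.
- apply: (@le_trans _ _ (\sum_(p : I * I) k^-1 * (x p.1 ^+ 2 * x p.2 ^+ 2))).
    apply: ler_sum => -[i j] _ /=; rewrite /a /=.
    have [_|ij] := eqVneq i j.
      rewrite /uavg /avg big1 ?mul0r => [|u _]; last by rewrite mul0r.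
      by rewrite mulr_ge0 ?(xx0 (i, j))// invr_ge0 ltW.
    rewrite -(uavg_collision r2 ij) le_eqVlt; apply/orP; left; apply/eqP.
    by rewrite [RHS]mulrC -[RHS]avgZ; apply: avg_ext => u; rewrite mulrC.
  rewrite -mulr_sumr -(pair_bigA _ (fun i j => x i ^+ 2 * x j ^+ 2))/=.
  by rewrite -big_distrlr/= x_norm !mulr1.
- by rewrite invr_ge0 ltW.
- by rewrite divr_gt0.
move=> u /andP[cu /forallP Bu] V Vn.
have collE : collision_mass u x (index_enum I) = \sum_p a p u.
  rewrite /collision_mass fiber_sum_sqr.
  have -> : \sum_i x i ^+ 4 = \sum_i (x i ^+ 2) ^+ 2.
    by apply: eq_bigr => i _; rewrite -exprM.
  by rewrite addrAC subrr add0r.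
(* A discarded input costs at most its square times the mass of its bucket, so [c2 * theta]. The
   function [g] covers both positions of that input in an ordered pair. *)
have half (g : I -> I -> R) : (forall i j, g i j = a (i, j) u \/ g i j = a (j, i) u) ->
    \sum_(i in V) \sum_j g i j <= 2 * n%:R * c2 * theta.
  move=> ga; apply: (@le_trans _ _ (#|V|%:R * (c2 * theta))); last first.
    rewrite -mulrA ler_wpM2r ?mulr_ge0 ?(ltW theta_gt0)//.
    by rewrite -natrM ler_nat.
  apply: sum_subset_le => i.
  apply: (@le_trans _ _ (x i ^+ 2 * bucket_mass u x (index_enum I) (u i))).
    rewrite /bucket_mass [X in _ * X]big_mkcond mulr_sumr; apply: ler_sum => j _.
    have [->|->] := ga i j; rewrite /a /=; case: (altP (u j =P u i)) => uij.
    - by rewrite uij eqxx andbT ler_piMl ?(xx0 (i, j))// lern1 leq_b1.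
    - by rewrite (eq_sym (u i)) (negbTE uij) andbF mul0r mulr0.
    - by rewrite andbT [leRHS]mulrC ler_piMl ?(xx0 (j, i))// lern1 leq_b1.
    - by rewrite andbF mul0r mulr0.
  by apply: ler_pM; rewrite ?sqr_ge0 ?bucket_mass_ge0.
have : \sum_p a p u <= \sum_(i in V) \sum_j a (i, j) u
    + \sum_(i in V) \sum_j a (j, i) u
    + \sum_(p : I * I | [disjoint [set p.1; p.2] & V]) a p u.
  have -> : \sum_(i in V) \sum_j a (i, j) u = \sum_(p | p.1 \in V) a p u.
    rewrite (pair_big (mem V) xpredT (fun i j => a (i, j) u)).
    by apply: eq_big => -[i j] //=; rewrite andbT.
  have -> : \sum_(i in V) \sum_j a (j, i) u = \sum_(p | p.2 \in V) a p u.
    rewrite exchange_big/= (pair_big xpredT (mem V) (fun i j => a (i, j) u)).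
    by apply: eq_big => -[i j].
  rewrite [X in _ <= X + _ + _]big_mkcond [X in _ <= _ + X + _]big_mkcond.
  rewrite [X in _ <= _ + _ + X]big_mkcond -!big_split/=; apply: ler_sum => -[i j] _ /=.
  rewrite disjoints_subset subUset !sub1set !inE.
  by case: (i \in V); case: (j \in V) => /=; have := a0 (i, j) u; lra.
have := half _ (fun i j => or_introl erefl).
have := half _ (fun i j => or_intror erefl).
by rewrite -collE; move: cu nc; lra.
Qed.

End HashTails.

(** This is the [n]-th power of [y / n%:R <= expR (y / n%:R)]. *)
Lemma exprn_le_expR (R : realType) (y : R) n : (0 < n)%N -> 0 <= y ->
  y ^+ n <= n%:R ^+ n * expR y.
Proof.
move=> n0 y0; have nR : 0 < n%:R :> R by rewrite ltr0n.
have -> : expR y = expR (y / n%:R) ^+ n.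
  by rewrite -expRM_natl mulrC divfK// lt0r_neq0.
rewrite -exprMn lerXn2r ?nnegrE ?mulr_ge0 ?expR_ge0 ?ler0n//.
rewrite -ler_pdivrMl// mulrC; apply: le_trans (expR_ge1Dx _).
by rewrite lerDr.
Qed.

(** * Tail of the error for signs of limited independence *)

Section SignTail.
Variables (R : realType) (I B : finType) (h : I -> B) (x : I -> R).
Variables (Omega : finType) (f : Omega -> I -> bool) (r : nat).
Hypothesis indep : rwise_independent R f r.
Hypothesis x_norm : \sum_i x i ^+ 2 = 1.

Definition sketch_error (sg : I -> bool) : R :=
  \sum_b signed_sum h x (index_enum I) sg b ^+ 2 - 1.

Lemma chaos_cst (a : R) sg :
  chaos h x (fun=> a) (index_enum I) sg = a * sketch_error sg.
Proof.
rewrite /chaos -mulr_sumr sumrB; congr (_ * (_ - _)).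
by rewrite -x_norm (partition_big h xpredT).
Qed.

(** The error is a sum over colliding pairs of products of two signs, so each factor of the power
    uses two inputs. *)
Lemma transfers_sketch_error l :
  transfers f r (2 * l) (fun u => sketch_error u ^+ l).
Proof.
elim: l => [|l IH].
  by rewrite muln0; apply: transfers_cst indep _ _; rewrite card_bool.
pose a (p : I * I) (u : I -> bool) : R := ((p.1 != p.2) && (h p.1 == h p.2))%:R *
  ((-1) ^+ u p.1 * x p.1 * ((-1) ^+ u p.2 * x p.2)).
rewrite mulnS; apply: (transfers_ext (g1 := fun u => \sum_p a p u * sketch_error u ^+ l)).
  move=> u; rewrite exprS -mulr_suml; congr (_ * _).
  have sgn2 : \sum_i ((-1) ^+ u i * x i) ^+ 2 = 1.
    by rewrite -[RHS]x_norm; apply: eq_bigr => i _; rewrite exprMn sqrr_sign mul1r.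
  by rewrite /sketch_error /signed_sum fiber_sum_sqr sgn2 addrAC subrr add0r.
apply: (transfers_sumM (supp := fun p : I * I => [set p.1; p.2])
  (g := fun _ u => sketch_error u ^+ l)) => // p _.
  by rewrite cards2; case: (_ != _).
by move=> u v uv; rewrite /a !uv ?set21 ?set22.
Qed.

(** Markov's inequality for the moment of order [2 * t], which may be computed with uniform signs.
    It is then bounded through [exprn_le_expR] by the two exponential moments at [lam] and [- lam],
    whence the factor [2]. *)
Lemma sign_tail (lam eps M : R) (t : nat) : (0 < t)%N -> (4 * t <= r)%N ->
  0 < lam -> 0 < eps ->
  (forall b, bucket_mass h x (index_enum I) b <= (32 * lam)^-1) ->
  collision_mass h x (index_enum I) <= M ->
  unif_prob R (fun w => eps < `|sketch_error (f w)|)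
  <= ((2 * t)%:R / (lam * eps)) ^+ (2 * t) * (2 * expR (16 * lam ^+ 2 * M)).
Proof.
move=> t0 tr lam0 eps0 Bh collM; set l := (2 * t)%N.
have l0 : (0 < l)%N by rewrite muln_gt0.
have even_pow (y : R) : y ^+ l = `|y| ^+ l.
  by rewrite /l !exprM -normrX ger0_norm// sqr_ge0.
have mgf a : `|a| = lam ->
    uavg (fun u => expR (a * sketch_error u)) <= expR (16 * lam ^+ 2 * M).
  move=> aE.
  have -> : uavg (fun u => expR (a * sketch_error u)) =
      uavg (fun u => expR (chaos h x (fun=> a) (index_enum I) u)).
    by apply: avg_ext => u; rewrite chaos_cst.
  have aa : - lam <= a <= lam by rewrite -ler_norml aE.
  case/andP: aa => a1 a2.
  (* With [Lam = 2 * lam] the upper condition on the weight reads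
     [lam <= 2 * lam - 32 * lam ^+ 2 * B], which holds for masses [B] up to [(32 * lam)^-1]. *)
  apply: le_trans (@uavg_expR_chaos _ _ _ h x (2 * lam) _ _ (index_enum_uniq _) _ _ _) _.
  - by rewrite mulr_ge0 ?ltW.
  - by move=> _; lra.
  - move=> b; have := Bh b; rewrite -div1r ler_pdivlMr ?mulr_gt0//.
    set y := bucket_mass _ _ _ _; rewrite !expr2 => By.
    have : lam * (y * (32 * lam)) <= lam * 1 by rewrite ler_wpM2l // ltW.
    by rewrite mulr1; lra.
  rewrite ler_expR (_ : 4 * (2 * lam) ^+ 2 = 16 * lam ^+ 2); last by ring.
  by rewrite ler_wpM2l// mulr_ge0// sqr_ge0.
have lr : (2 * l <= r)%N by rewrite /l mulnA.
apply: (@le_trans _ _ (avg (fun w => sketch_error (f w) ^+ l) / eps ^+ l)).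
  apply: unif_prob_markov => [|w|w ew]; first by rewrite exprn_gt0.
    by rewrite even_pow exprn_ge0.
  by rewrite (even_pow (sketch_error _)) lerXn2r ?nnegrE ?(ltW eps0)// ltW.
rewrite (transfers_avg lr (@transfers_sketch_error l)).
rewrite ler_pdivrMr ?exprn_gt0//.
apply: (@le_trans _ _ (uavg (fun u => (l%:R / lam) ^+ l *
   (expR (lam * sketch_error u) + expR (- lam * sketch_error u))))).
  apply: ler_avg => u; rewrite even_pow.
  rewrite expr_div_n mulrAC ler_pdivlMr ?exprn_gt0// -exprMn.
  have Z0 : 0 <= `|sketch_error u| * lam by rewrite mulr_ge0// ltW.
  apply: le_trans (exprn_le_expR l0 Z0) _; rewrite ler_wpM2l ?exprn_ge0//.
  case: (lerP 0 (sketch_error u)) => s0.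
    by rewrite ger0_norm// mulrC lerDl expR_ge0.
  by rewrite ltr0_norm// mulrC mulrN mulNr lerDr expR_ge0.
rewrite /uavg avgZ avgD.
have -> : (l%:R / (lam * eps)) ^+ l * (2 * expR (16 * lam ^+ 2 * M)) * eps ^+ l
   = (l%:R / lam) ^+ l * (2 * expR (16 * lam ^+ 2 * M)).
  rewrite mulrAC -exprMn; congr (_ ^+ _ * _); field.
  by rewrite !lt0r_neq0.
rewrite ler_wpM2l ?exprn_ge0 ?divr_ge0 ?(ltW lam0)// mulr_natl mulr2n.
by apply: lerD; apply: mgf; rewrite ?normrN gtr0_norm.
Qed.

End SignTail.

(** * Logarithms, rounding and a numerical estimate *)

Lemma ler_log2 (R : realType) (a b : R) : 0 < a -> a <= b -> log2 a <= log2 b.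
Proof.
move=> a0 ab; have ln2 : 0 < ln 2 :> R by rewrite ln_gt0// ltr1n.
by rewrite /log2 ler_pM2r ?invr_gt0// ler_ln ?posrE// (lt_le_trans a0).
Qed.

Lemma log2_2 (R : realType) : log2 2 = 1 :> R.
Proof. by rewrite /log2 divff// gt_eqF// ln_gt0// ltr1n. Qed.

Lemma le_pow2_log2 (R : realType) (y : R) n :
  0 < y -> log2 y <= n%:R -> y <= 2 ^+ n.
Proof.
move=> y0; have ln2 : 0 < ln 2 :> R by rewrite ln_gt0// ltr1n.
rewrite /log2 ler_pdivrMr// mulr_natl -lnXn//.
by rewrite ler_ln ?posrE ?exprn_gt0.
Qed.

(** Supplies integer moment orders; the factor [2] lost here is absorbed by the constants in [rh_ge]
    and [rs_ge]. *)
Lemma exists_natr_double (R : realType) (y : R) : 1 <= y ->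
  exists n, [/\ (0 < n)%N, y <= n%:R & n%:R <= 2 * y].
Proof.
move=> y1; exists (Num.truncn y).+1; split=> //; first exact/ltW/truncnS_gt.
have : (Num.truncn y)%:R <= y by rewrite truncn_le (le_trans ler01).
by rewrite -natr1; lra.
Qed.

(** From [expR (- (4 / 7)) >= 3 / 7 >= 1 / 4]. *)
Lemma expR_4_7_le (R : realType) (t : nat) : expR (4 / 7 * t%:R : R) <= 4 ^+ t.
Proof.
rewrite expRM_natr lerXn2r ?nnegrE ?expR_ge0//.
have := expR_ge1Dx (- (4 / 7) : R); rewrite expRN => e.
rewrite -[leLHS]invrK invf_ple ?posrE ?invr_gt0 ?expR_gt0//.
by apply: le_trans e; lra.
Qed.

(** * Choice of parameters and the three failure probabilities *)

Section SketchTail.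
Variables (R : realType) (I B : finType) (x : I -> R) (eps delta : R).
Variables (H S : finType) (h : H -> I -> B) (sg : S -> I -> bool) (rh rs : nat).
Hypothesis indep_h : rwise_independent R h rh.
Hypothesis indep_sg : rwise_independent R sg rs.
Hypothesis eps01 : 0 < eps < 1.
Hypothesis delta_bd : 0 < delta < 1 / 2.

Variables k L P : R.
Hypothesis kE : k = #|B|%:R.
Hypothesis LE : L = log2 (1 / delta).
Hypothesis PE : P = log2 (k / delta).
Local Notation k0 := (28 * 64 ^+ 2 * L / eps ^+ 2).
Local Notation theta := (eps / (16 * 64 * L)).

Hypothesis k_ge : k0 <= k.
Hypothesis k_le : k <= k0 + 1.
Hypothesis rh_ge : 4 * P <= rh%:R.
Hypothesis rs_ge : 8 * L <= rs%:R.
Hypothesis x_norm : \sum_i x i ^+ 2 = 1.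
Hypothesis x_small : forall i, x i ^+ 2 <= eps / (64 ^+ 2 * L * P).

Let eps0 : 0 < eps. Proof. by case/andP: eps01. Qed.
Let delta0 : 0 < delta. Proof. by case/andP: delta_bd. Qed.

Let L1 : 1 <= L.
Proof.
rewrite LE -[leLHS](log2_2 R) ler_log2// ler_pdivlMr//.
by case/andP: delta_bd => _; lra.
Qed.

Let L0 : 0 < L. Proof. exact: lt_le_trans ltr01 L1. Qed.

Let k0_ge1 : 1 <= k0.
Proof.
rewrite ler_pdivlMr ?exprn_gt0// mul1r.
have : eps ^+ 2 <= 1 by rewrite expr_le1// ?ltW//; case/andP: eps01.
by move: L1; lra.
Qed.

Let k_gt0 : 0 < k. Proof. by move: k0_ge1 k_ge; lra. Qed.

Let B_gt0 : (0 < #|B|)%N. Proof. by rewrite -(ltr0n R) -kE. Qed.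

Let LP : L <= P.
Proof.
rewrite LE PE ler_log2 ?divr_gt0// ler_wpM2r ?invr_ge0 ?(ltW delta0)//.
by apply: le_trans k_ge.
Qed.

Let P0 : 0 < P. Proof. exact: lt_le_trans L0 LP. Qed.

Let theta0 : 0 < theta. Proof. by rewrite divr_gt0//; move: L0; lra. Qed.

Let c0 : 0 <= eps / (64 ^+ 2 * L * P).
Proof. by rewrite ltW// divr_gt0// mulr_gt0// mulr_gt0// exprn_gt0. Qed.

Let heavy_bucket (u : I -> B) b := theta < bucket_mass u x (index_enum I) b.

(** Union bound over [k] buckets, each heavy with probability at most [2^-1 ^+ n <= delta / k]
    because [n >= P]. *)
Lemma heavy_bucket_prob :
  unif_prob R (fun w => [exists b, heavy_bucket (h w) b]) <= delta.
Proof.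
have [n [n0 Pn nP]] := exists_natr_double (le_trans L1 LP).
apply: le_trans (unif_prob_exists _ _) _.
apply: (@le_trans _ _ (\sum_(b : B) delta / k)); last first.
  by rewrite sumr_const -[leLHS]mulr_natr -kE divfK// gt_eqF.
apply: ler_sum => b _.
have nr : (n <= rh)%N by rewrite -(ler_nat R); move: P0 nP rh_ge; lra.
apply: le_trans (bucket_tail indep_h B_gt0 x_norm x_small c0 theta0 b n0 nr _) _.
  apply: (@le_trans _ _ (2 * P * (eps / (64 ^+ 2 * L * P)))).
    by rewrite ler_wpM2r.
  by rewrite le_eqVlt; apply/orP; left; apply/eqP; field; rewrite !lt0r_neq0.
(* The base is at most one half, since [k * theta >= k0 * theta = 112 / eps >= 4]. *)
rewrite -kE; apply: (@le_trans _ _ (2^-1 ^+ n)).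
  have kt0 : 0 < k * theta by rewrite mulr_gt0.
  apply: lerXn2r; rewrite ?nnegrE ?invr_ge0// ?divr_ge0 ?(ltW kt0)//.
  rewrite ler_pdivrMr//.
  have : k0 * theta <= k * theta by rewrite ler_wpM2r// ltW.
  have -> : k0 * theta = 112 / eps by field; rewrite !lt0r_neq0.
  have : 112 <= 112 / eps.
    rewrite ler_pdivlMr// ler_piMr//.
    by rewrite ltW//; case/andP: eps01.
  by lra.
rewrite exprVn -[leRHS]invf_div lef_pV2 ?posrE ?exprn_gt0 ?divr_gt0//.
by apply: le_pow2_log2; rewrite -?PE// divr_gt0.
Qed.

Lemma many_collisions_prob :
  unif_prob R (fun w => (4 / #|B|%:R < collision_mass (h w) x (index_enum I)) &&
    [forall b, bucket_mass (h w) x (index_enum I) b <= theta]) <= delta.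
Proof.
have [t [t0 Lt tL]] := exists_natr_double L1.
have tr : (2 * t <= rh)%N by rewrite -(ler_nat R) natrM; move: LP rh_ge tL; lra.
apply: le_trans (collision_tail indep_h B_gt0 x_norm x_small c0 theta0 t0 tr _) _.
  (* The intermediate value is the inverse of [k0]; it is at most [2 / k] because rounding gives
     [k <= k0 + 1 <= 2 * k0]. *)
  rewrite -kE; apply: (@le_trans _ _ (eps ^+ 2 / (28 * 64 ^+ 2 * L))); last first.
    have -> : eps ^+ 2 / (28 * 64 ^+ 2 * L) = k0^-1.
      by field; rewrite !lt0r_neq0.
    rewrite ler_pdivlMr// ler_pdivrMl ?(lt_le_trans _ k0_ge1)//.
    by move: k0_ge1 k_le; lra.
  apply: (@le_trans _ _ (4 * (2 * L) * (eps / (64 ^+ 2 * L * L)) * theta)).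
    rewrite ler_wpM2r ?(ltW theta0)//; apply: ler_pM => //.
    - by rewrite mulr_ge0.
    - by rewrite ler_wpM2l.
    rewrite ler_wpM2l ?(ltW eps0)// lef_pV2 ?posrE ?mulr_gt0//.
    by rewrite ler_wpM2l// mulr_ge0 ?exprn_ge0 ?(ltW L0)//.
  have -> : 4 * (2 * L) * (eps / (64 ^+ 2 * L * L)) * theta
      = (eps ^+ 2 / (28 * 64 ^+ 2 * L)) * (7 / 32 / L).
    by field; rewrite !lt0r_neq0.
  rewrite ler_piMr ?divr_ge0 ?sqr_ge0 ?mulr_ge0 ?(ltW L0)//.
  by rewrite ler_pdivrMr//; move: L1; lra.
rewrite exprVn -[leRHS]invrK -[delta^-1]div1r lef_pV2 ?posrE ?exprn_gt0 ?divr_gt0//.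
by apply: le_pow2_log2; rewrite -?LE// divr_gt0.
Qed.

(** With [lam = 32 * L / eps], [theta] is exactly the threshold of [sign_tail]. The moment factor is
    at most [(1 / 8) ^+ (2 * t)] and the exponential one at most [4 ^+ t], together
    [(2^-1 ^+ t) ^+ 4 <= delta ^+ 4]. *)
Lemma sketch_error_prob (u : I -> B) :
  (forall b, ~~ heavy_bucket u b) ->
  collision_mass u x (index_enum I) <= 4 / #|B|%:R ->
  unif_prob R (fun w => eps < `|sketch_error u x (sg w)|) <= 2 * delta ^+ 4.
Proof.
move=> light coll.
have [t [t0 Lt tL]] := exists_natr_double L1.
have tr : (4 * t <= rs)%N by rewrite -(ler_nat R) natrM; move: tL rs_ge; lra.
pose lam := 32 * L / eps.
have lam0 : 0 < lam by rewrite divr_gt0// mulr_gt0.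
apply: le_trans (sign_tail indep_sg x_norm t0 tr lam0 eps0 _ coll) _.
  move=> b; have := light b; rewrite -leNgt => /le_trans; apply.
  by rewrite /lam le_eqVlt; apply/orP; left; apply/eqP; field; rewrite !lt0r_neq0.
have e1 : (2 * t)%:R / (lam * eps) <= 1 / 8.
  have -> : lam * eps = 32 * L by rewrite /lam divfK// gt_eqF.
  by rewrite ler_pdivrMr ?mulr_gt0// natrM; lra.
have e2 : expR (16 * lam ^+ 2 * (4 / #|B|%:R)) <= 4 ^+ t.
  apply: le_trans (expR_4_7_le R t); rewrite ler_expR.
  rewrite -kE; apply: (@le_trans _ _ (16 * lam ^+ 2 * (4 / k0))).
    apply: ler_wpM2l; first by rewrite mulr_ge0 ?sqr_ge0.
    apply: ler_wpM2l => //; rewrite lef_pV2 ?posrE//.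
    exact: lt_le_trans ltr01 k0_ge1.
  have -> : 16 * lam ^+ 2 * (4 / k0) = 4 / 7 * L.
    by rewrite /lam; field; rewrite !lt0r_neq0.
  by rewrite ler_wpM2l// divr_ge0.
apply: (@le_trans _ _ ((1 / 8) ^+ (2 * t) * (2 * 4 ^+ t))).
  apply: ler_pM.
  - by rewrite exprn_ge0// divr_ge0// ?ler0n// mulr_ge0 ?ltW.
  - by rewrite mulr_ge0 ?expR_ge0.
  - by rewrite lerXn2r// nnegrE divr_ge0 ?ler0n// mulr_ge0 ?ltW.
  - by rewrite ler_wpM2l.
have -> : (1 / 8) ^+ (2 * t) * (2 * 4 ^+ t) = 2 * (2^-1 ^+ t) ^+ 4 :> R.
  rewrite exprM mulrCA -exprMn -exprM mulnC exprM; congr (_ * _ ^+ _).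
  by field.
rewrite ler_wpM2l// lerXn2r ?nnegrE ?exprn_ge0 ?invr_ge0 ?(ltW delta0)//.
rewrite exprVn -[leRHS]invrK -[delta^-1]div1r lef_pV2 ?posrE ?exprn_gt0 ?divr_gt0//.
by apply: le_pow2_log2; rewrite -?LE// divr_gt0.
Qed.

(** Hashing fails with probability at most [2 * delta], and the signs add [2 * delta ^+ 4 < delta].
    The function [v] serves to show that [H] is nonempty. *)
Lemma sketch_tail (v : I -> B) :
  unif_prob R (fun w : H * S => eps < `|sketch_error (h w.1) x (sg w.2)|)
  < 3 * delta.
Proof.
pose bad (w : H) := [exists b, heavy_bucket (h w) b] ||
  ((4 / #|B|%:R < collision_mass (h w) x (index_enum I)) &&
    [forall b, bucket_mass (h w) x (index_enum I) b <= theta]).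
have H0 := rwise_card_gt0 indep_h v.
have d4 : 2 * delta ^+ 4 < delta.
  have d3 : delta ^+ 3 < (1 / 2) ^+ 3.
    by case/andP: delta_bd => d1 d2; rewrite ltrXn2r// ?nnegrE ?ltW.
  rewrite exprS mulrCA gtr_pMr//.
  by apply: le_lt_trans (_ : 2 * (1 / 2) ^+ 3 < 1); [rewrite ler_wpM2l// ltW|lra].
have bad_le : unif_prob R bad <= delta + delta.
  apply: le_trans (unif_prob_or _ _ _) _.
  by apply: lerD; [exact: heavy_bucket_prob|exact: many_collisions_prob].
have p0 : 0 <= 2 * delta ^+ 4 by rewrite mulr_ge0// exprn_ge0// ltW.
have := @unif_prob_fiber_le R H S bad
  (fun w s => eps < `|sketch_error (h w) x (sg s)|) _ p0 H0 _.
move=> /(_ _)/le_lt_trans; apply; last by lra.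
move=> w; rewrite negb_or negb_exists negb_and -leNgt.
move=> /andP[/forallP light /orP[coll|/negP[]]]; first exact: sketch_error_prob.
by apply/forallP => b; rewrite leNgt; apply: light.
Qed.

End SketchTail.

(** * From the sketch matrix to bucket sums *)

Lemma mx_entry_le_norm (R : realType) m n (A : 'M[R]_(m, n)) i j :
  `|A i j| <= `|A|.
Proof.
rewrite [leRHS]/Num.Def.normr /= mx_normrE.
exact: (le_bigmax _ (fun ij => `|A ij.1 ij.2|) (i, j)).
Qed.

Lemma l2norm_sketch (R : realType) k d (h : 'I_d -> 'I_k) (sg : 'I_d -> bool)
    (x : 'cV[R]_d) :
  l2norm (sketch_mx R h sg *m x) ^+ 2 - 1 = sketch_error h (x^~ 0) sg.
Proof.
rewrite /l2norm sqr_sqrtr ?sumr_ge0// => [|i _]; last by rewrite sqr_ge0.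
congr (_ - 1); apply: eq_bigr => i _; congr (_ ^+ 2).
rewrite mxE /signed_sum [RHS]big_mkcond; apply: eq_bigr => j _; rewrite mxE.
by case: eqP; rewrite ?mul1r ?mul0r.
Qed.

Lemma sketch_dim_bounds (R : realType) (eps delta k0 : R) :
  0 < eps -> 0 < log2 (1 / delta) ->
  k0 = 28 * 64 ^+ 2 * log2 (1 / delta) / eps ^+ 2 ->
  k0 <= (sketch_dim eps delta)%:R <= k0 + 1.
Proof.
move=> eps0 L0 k0E.
have k00 : 0 < k0 by rewrite k0E divr_gt0 ?exprn_gt0// mulr_gt0// mulr_gt0// exprn_gt0.
have -> : (sketch_dim eps delta)%:R = (Num.ceil k0)%:~R :> R.
  rewrite /sketch_dim (_ : _ * log2 _ = k0); last by rewrite k0E mulrAC.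
  by rewrite natr_absz ger0_norm// ltW// ceil_gt0.
rewrite ceil_ge/=; have := ceilB1_lt k0.
by rewrite intrB => /ltW; rewrite lerBlDr.
Qed.

(* `|x| is the sup norm of the column vector x; the seed (w.1, w.2) is uniform
   on H * S, that is, h and sigma are drawn independently. *)
Theorem theorem3 (R : realType) :
  exists eps0 C1 C2 C3 : R,
    [/\ 0 < eps0, 0 < C1, 0 < C2 & 0 < C3] /\
    forall (d : nat) (eps delta : R),
      (1 <= d)%N -> 0 < eps < eps0 -> 0 < delta < 1 / 2 ->
      let k := sketch_dim eps delta in
      let c := C3 * Num.sqrt
        (eps / (log2 (1 / delta) * log2 (k%:R / delta))) in
      forall (r_h r_sigma : nat),
        C1 * log2 (k%:R / delta) <= r_h%:R ->
        C2 * log2 (1 / delta) <= r_sigma%:R ->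
      forall (H S : finType)
        (h : H -> 'I_d -> 'I_k) (sigma : S -> 'I_d -> bool),
        rwise_independent R h r_h ->
        rwise_independent R sigma r_sigma ->
      forall x : 'cV[R]_d,
        l2norm x = 1 -> `|x| <= c ->
        unif_prob R (fun w : H * S =>
          eps < `| l2norm (sketch_mx R (h w.1) (sigma w.2) *m x) ^+ 2 - 1 |)
        < 3 * delta.
Proof.
(* Rounded orders are at most [2 * P] for heavy buckets and [2 * L] elsewhere. Hashing thus needs at
   most [4 * P] inputs and the signs [4 * t <= 8 * L]; [1 / 64] gives
   [c ^+ 2 = eps / (64 ^+ 2 * L * P)]. *)
exists 1, 4, 8, (1 / 64); split; first by split=> //; rewrite divr_gt0.
move=> d eps delta d1 /andP[eps0 eps1] /andP[delta0 delta2] k c rh rs rh_ge rs_ge.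
move=> H S h sg indep_h indep_sg x x1 xc.
pose L := log2 (1 / delta); pose P := log2 (k%:R / delta).
have L1 : 1 <= L.
  by rewrite -[leLHS](log2_2 R) ler_log2// ler_pdivlMr//; lra.
have L0 : 0 < L by lra.
have /andP[k_ge k_le] := sketch_dim_bounds eps0 L0 erefl.
have k1 : 1 <= k%:R :> R.
  apply: le_trans k_ge; rewrite ler_pdivlMr ?exprn_gt0// -/L mul1r.
  have : eps ^+ 2 <= 1 by rewrite expr_le1// ltW.
  by move: L1; lra.
have P0 : 0 < P.
  apply: lt_le_trans L0 _; rewrite ler_log2 ?divr_gt0// ler_wpM2r ?invr_ge0//.
  exact: ltW.
have x_norm : \sum_i x i 0 ^+ 2 = 1.
  rewrite -[RHS](expr1n _ 2) -x1 /l2norm sqr_sqrtr// sumr_ge0// => i _.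
  by rewrite sqr_ge0.
have x_small i : x i 0 ^+ 2 <= eps / (64 ^+ 2 * L * P).
  have -> : eps / (64 ^+ 2 * L * P) = c ^+ 2.
    rewrite /c -/L -/P exprMn sqr_sqrtr; last by rewrite ltW// divr_gt0// mulr_gt0.
    by field; rewrite !lt0r_neq0.
  rewrite -real_normK ?num_real// lerXn2r ?nnegrE//.
    by rewrite mulr_ge0 ?sqrtr_ge0// divr_ge0.
  exact: le_trans (mx_entry_le_norm x i 0) xc.
have k_gt0 : (0 < k)%N by rewrite -(ltr0n R); lra.
have -> : unif_prob R (fun w : H * S =>
    eps < `|l2norm (sketch_mx R (h w.1) (sg w.2) *m x) ^+ 2 - 1|) =
  unif_prob R (fun w : H * S => eps < `|sketch_error (h w.1) (x^~ 0) (sg w.2)|).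
  by rewrite !unif_probE; apply: avg_ext => w; rewrite l2norm_sketch.
have eps01 : 0 < eps < 1 by rewrite eps0.
have delta_bd : 0 < delta < 1 / 2 by rewrite delta0.
have kE : k%:R = #|'I_k|%:R :> R by rewrite card_ord.
exact: (sketch_tail indep_h indep_sg eps01 delta_bd kE erefl erefl k_ge k_le
  rh_ge rs_ge x_norm x_small (fun=> Ordinal k_gt0)).
Qed.
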